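(* Let $\kappa\ge1$ be an integer and $\chi>1$ real. Consider the class of all instances with capacity $C=n_{\max}=1$ (so $n_i=1$ for every job) and with all job lengths in $[1,\kappa]$. On this class the greedy mechanism $\Gamma_G$ with the exponential priority function $f(\delta)=\chi^{\delta}$ has competitive ratio exactly $$\frac{\chi}{1-\chi^{-1/\kappa}}+1 ,$$ i.e. it is $c$-competitive for $c$ equal to this number and for no smaller $c$.
   Context: Setting. A cloud provider has $C\in\mathbb{N}$ identical instances at every time $t\in[0,\infty)$. A job sequence $\theta$ is a finite list of jobs $\theta_i=(r_i,d_i,n_i,l_i,v_i)$: release time $r_i\ge0$, deadline $d_i$, required number of instances $n_i$ (positive integer, $n_i\le n_{\max}\le C$), length $l_i\in[1,\kappa]$ ($\kappa$ a positive integer), value $v_i>0$. Nothing is known about job $i$ before time $r_i$. An allocation is feasible if at every time the total number of allocated instances is at most $C$. Job $i$ is completed if it receives at least $n_i$ instances continuously for $l_i$ time units between $r_i$ and $d_i$; an interrupted job loses all its progress but may be restarted from scratch. The social welfare of an allocation is the sum of the values of the completed jobs. $OPT(\theta)$ is the maximum social welfare of a feasible allocation computed offline with full knowledge of $\theta$; $W(M,\theta)$ is the social welfare obtained by the online mechanism $M$ on $\theta$ (with truthful reports). Competitiveness. $M$ is $c$-competitive on a class of instances if no instance in the class satisfies $c\cdot W(M,\theta)<OPT(\theta)$. The competitive ratio of $M$ on the class is the least such $c$ ($\infty$ if there is none). Mechanism $\Gamma_G$ with priority function $f$ ($f:[0,1]\to\mathbb{R}$ non-decreasing, $f(0)=1$).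 At time $t$ let $\delta_i\in[0,1]$ be the fraction of $l_i$ for which job $i$ has been continuously processed up to $t$ in its current uninterrupted run ($\delta_i=0$ if it is not running). Job $i$ is feasible at $t$ if $r_i\le t$, $d_i-t\ge(1-\delta_i)l_i$, and it has not been completed. A time is critical if a job is released or a running job is completed at that time. At every critical time $t$, in increasing order: let $J_F$ be the set of feasible jobs; set $v_i'=v_if(\delta_i)$ and $\rho_i'=\frac{v_i}{n_i}f(\delta_i)$; number the jobs of $J_F$ by descending $\rho_i'$ (ties broken by an arbitrary fixed rule). If the total demand $\sum n_i$ of all jobs in $J_F$ is at most $C$, run all of $J_F$. Otherwise let $k$ be the smallest index with $n_1+\dots+n_k>C$; if $\sum_{i=1}^{k-1}v_i'\ge v_k'$ run jobs $1,\dots,k-1$, else run only job $k$. The chosen jobs run (job $i$ on $n_i$ instances) until the next critical time; running jobs that are not chosen are interrupted. (Each completed job pays its critical value, the minimum reported value for which it would be completed; payments do not affect social welfare.) *)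

(* Defs.v *)
From mathcomp Require Import all_boot all_order all_algebra.
From mathcomp Require Import all_classical all_reals all_analysis.

Set Implicit Arguments.
Unset Strict Implicit.
Unset Printing Implicit Defensive.

Import Order.TTheory GRing.Theory Num.Theory.
Local Open Scope ring_scope.

Record job (R : realType) := Job {
  release : R;
  deadline : R;
  demand : nat;
  len : R;
  value : R }.

Definition job_seq (R : realType) (n : nat) := 'I_n -> job R.

(* [a t i] is the number of instances given to job [i] at time [t]. *)
Definition allocation (R : realType) (n : nat) := R -> 'I_n -> nat.

(* Reports are truthful and payments do not enter the social welfare, so a
   mechanism is represented by the allocation it produces. *)
Definition mechanism (R : realType) :=
  forall n : nat, job_seq R n -> allocation R n.

Definition in_class (R : realType) (nmax kappa n : nat) (theta : job_seq R n)
    : Prop :=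
  forall i : 'I_n,
    [/\ 0 <= release (theta i),
        (0 < demand (theta i) <= nmax)%N,
        1 <= len (theta i) <= kappa%:R
      & 0 < value (theta i)].

Section Welfare.
Variables (R : realType) (n : nat) (theta : job_seq R n).

Definition alloc_feasible (C : nat) (a : allocation R n) : Prop :=
  forall t : R, 0 <= t -> (\sum_(i < n) a t i <= C)%N.

(* Processing intervals are half-open, so that a job may start at the very
   instant at which another one ends. *)
Definition completed (a : allocation R n) (i : 'I_n) : Prop :=
  exists s : R,
    [/\ release (theta i) <= s,
        s + len (theta i) <= deadline (theta i)
      & forall t : R, s <= t < s + len (theta i) ->
          (demand (theta i) <= a t i)%N].

Definition welfare (a : allocation R n) : R :=
  \sum_(i < n | `[< completed a i >]) value (theta i).

(* Only finitely many welfare values are possible and the zero allocation is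
   feasible, so this supremum is a maximum. *)
Definition OPT (C : nat) : R :=
  sup [set w : R | exists2 a, alloc_feasible C a & w = welfare a]%classic.

End Welfare.

Definition competitive (R : realType) (C nmax kappa : nat) (M : mechanism R)
    (c : R) : Prop :=
  forall (n : nat) (theta : job_seq R n), in_class nmax kappa theta ->
    ~ (c * welfare theta (M n theta) < OPT theta C).

Definition is_competitive_ratio (R : realType) (C nmax kappa : nat)
    (M : mechanism R) (c : R) : Prop :=
  competitive C nmax kappa M c /\
  forall c' : R, competitive C nmax kappa M c' -> c <= c'.

(* A tie-breaking rule orders candidates, each described by its index in the
   job sequence, its parameters and its current processed fraction. *)
Definition tie_rule (R : realType) := rel (nat * job R * R).

Definition is_tie_rule (R : realType) (tie : tie_rule R) : Prop :=
  [/\ total tie, antisymmetric tie & transitive tie].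

Section Greedy.
Variables (R : realType) (C : nat) (f : R -> R) (tie : tie_rule R).
Variables (n : nat) (theta : job_seq R n).

(* State right after the decision taken at the critical time [now]: [start i]
   is [Some s] if job [i] is running in an uninterrupted run begun at time [s],
   and [None] if it is not running. *)
Record state := State {
  now : R;
  start : 'I_n -> option R;
  finished : pred 'I_n }.

Definition fraction (st : state) (t : R) (i : 'I_n) : R :=
  if start st i is Some s then (t - s) / len (theta i) else 0.

Definition next_critical (st : state) : option R :=
  ohead (sort <=%R
    ([seq release (theta i) | i <- enum 'I_n & now st < release (theta i)] ++
     pmap (fun i => omap (fun s => s + len (theta i)) (start st i))
          (enum 'I_n))).

Definition finished_at (st : state) (t : R) : pred 'I_n :=
  fun i => finished st i || (start st i && (fraction st t i == 1)).

Definition job_feasible (st : state) (t : R) (i : 'I_n) : bool :=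
  [&& release (theta i) <= t,
      (1 - fraction st t i) * len (theta i) <= deadline (theta i) - t
    & ~~ finished_at st t i].

(* [v_i'] and [rho_i'] *)
Definition vprio (st : state) (t : R) (i : 'I_n) : R :=
  value (theta i) * f (fraction st t i).

Definition rhoprio (st : state) (t : R) (i : 'I_n) : R :=
  value (theta i) / (demand (theta i))%:R * f (fraction st t i).

Definition before (st : state) (t : R) : rel 'I_n := fun i j =>
  (rhoprio st t j < rhoprio st t i) ||
  ((rhoprio st t i == rhoprio st t j) &&
   tie (i : nat, theta i, fraction st t i) (j : nat, theta j, fraction st t j)).

Definition candidates (st : state) (t : R) : seq 'I_n :=
  sort (before st t) [seq i <- enum 'I_n | job_feasible st t i].

(* Position, counted from 0, of the first job that overflows the capacity. *)
Definition overflow (s : seq 'I_n) : nat :=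
  find (fun k => (C < \sum_(i <- take k.+1 s) demand (theta i))%N)
       (iota 0 (size s)).

(* The last branch is unreachable: if the total demand exceeds [C], then
   [overflow s < size s]. *)
Definition chosen (st : state) (t : R) : seq 'I_n :=
  let s := candidates st t in
  if (\sum_(i <- s) demand (theta i) <= C)%N then s
  else if drop (overflow s) s is k :: _ then
    let top := take (overflow s) s in
    if vprio st t k <= \sum_(i <- top) vprio st t i then top else [:: k]
  else s.

Definition step (st : state) : state :=
  if next_critical st is Some t then
    State t
      (fun i => if i \in chosen st t
                then Some (odflt t (start st i)) else None)
      (finished_at st t)
  else st.

(* The initial clock lies strictly before every release time, so that releases
   at time 0 are critical. *)
Definition init : state := State (- 1) (fun=> None) pred0.

Definition trace (k : nat) : state := iter k step init.

(* If [trace k] has no next critical time then no job is running in it and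
   [trace k.+1 = trace k]. *)
Definition greedy_alloc : allocation R n := fun t i =>
  if `[< exists k : nat, (now (trace k) <= t < now (trace k.+1)) /\
                         start (trace k) i >]
  then demand (theta i) else 0%N.

End Greedy.

Definition GammaG (R : realType) (C : nat) (f : R -> R) (tie : tie_rule R)
    : mechanism R :=
  fun n theta => greedy_alloc C f tie theta.

(* Main.v *)
Require Import Defs.
From mathcomp Require Import all_boot all_order all_algebra.
From mathcomp Require Import all_classical all_reals all_analysis.
From mathcomp Require Import lra ring zify.

(* With C = 1 the mechanism always runs the startable or running job of highest
   priority v * chi^delta.

   Upper bound.  If an offline schedule starts at time s a job i that the
   mechanism never completes, then at time s the mechanism runs a job of
   priority at least v_i.  Priorities only increase along a chain of
   preemptions, by a factor of at least chi^(1/kappa) per unit of time, and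
   such a chain ends with the completion, at some time e, of a job m of final
   priority chi * v_m.  Hence v_i <= chi * v_m * chi^(-(e - s)/kappa).  Offline
   starts are at least one unit apart, so the jobs charged to the same m add up
   to at most a geometric series, chi * v_m / (1 - chi^(-1/kappa)).  The jobs
   completed by both account for the term 1.

   Lower bound.  Blockers of length kappa are released slightly less than one
   unit apart, blocker i having value chi^(i/kappa), so that each one barely
   preempts its predecessor and only the last one, of index M, is completed.
   At every integer time 1, ..., M + kappa a victim of length 1 and of value
   slightly below the current priority is released, with no slack.  The
   offline schedule completes all the victims and, afterwards, blocker M. *)

Import Order.TTheory GRing.Theory Num.Theory.
Local Open Scope ring_scope.

(** * Real powers, sorted lists and sums over spaced exponents *)

Lemma ltr_powR_base_gt1 (R : realType) (a x y : R) :
  1 < a -> x < y -> a `^ x < a `^ y.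
Proof.
move=> a1 xy; have a0 : 0 < a by lra.
rewrite /powR gt_eqF // ltr_expR ltr_pM2r //.
by rewrite ln_gt0.
Qed.

Lemma powRD_gt0 (R : realType) (a x y : R) :
  0 < a -> a `^ (x + y) = a `^ x * a `^ y.
Proof. by move=> a0; rewrite powRD ?lt0r_neq0 ?implybT. Qed.

Lemma ohead_sortP (R : realType) (l : seq R) :
  match ohead (sort <=%R l) with
  | Some t => t \in l /\ {in l, forall x, t <= x}
  | None => l = [::]
  end.
Proof.
have := mem_sort <=%R l; have := sort_sorted (@le_total _ R) l.
case E : (sort <=%R l) => [|t s] /= srt ml.
  by apply/eqP; rewrite -size_eq0 -(size_sort <=%R) E.
split=> [|x]; first by rewrite -ml mem_head.
rewrite -ml inE => /predU1P[->//|xs].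
by move: srt => /(order_path_min (@le_trans _ R))/allP/(_ _ xs).
Qed.

(** Once the least exponent [x i] is removed, all the others are at least [x i + 1]. Induction on
    the cardinality then reproduces the recursion of a geometric series. *)
Lemma sum_spaced_powR (R : realType) (T : finType) (A : {set T}) (x : T -> R)
    (b y : R) :
  0 < b < 1 -> (forall i, i \in A -> y <= x i) ->
  (forall i j, i \in A -> j \in A -> i != j ->
     x i + 1 <= x j \/ x j + 1 <= x i) ->
  \sum_(i in A) b `^ x i <= b `^ y / (1 - b).
Proof.
move=> /andP[b0 b1]; have [m] := ubnP #|A|; elim: m A y => // m IH A y.
rewrite ltnS => cA yA spaced; have b1' : 0 < 1 - b by lra.
have [->|[i0 i0A]] := set_0Vmem A.
  by rewrite big_set0 divr_ge0 ?powR_ge0 ?(ltW b1').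
have := i0A; case: (arg_minP x i0A) => i iA0 imin _.
have iA : i \in A by exact: iA0.
rewrite (big_setD1 i iA) /=.
have /IH -/(_ (x i + 1))IHi : (#|A :\ i| < m)%N.
  by rewrite (leq_trans _ cA) // (cardsD1 i A) iA.
have -> : b `^ y / (1 - b) = b `^ y + b `^ y * b / (1 - b).
  by field; rewrite lt0r_neq0.
have xy : b `^ x i <= b `^ y by apply: ger_powR; [rewrite b0 ltW|apply: yA].
apply: (lerD xy); apply: (le_trans (IHi _ _)).
- move=> j /setD1P[ji jA]; have := imin j jA.
  by have [|] := spaced _ _ jA iA ji; lra.
- by move=> j k /setD1P[_ jA] /setD1P[_ kA]; apply: spaced.
rewrite powRD_gt0 // powRr1 ?(ltW b0) // ler_pM2r ?invr_gt0 //.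
by rewrite ler_pM2r.
Qed.

(** * The decision rule with unit capacity and unit demands *)

Section UnitCapacityGreedy.
Variables (R : realType) (kappa : nat) (chi : R) (tie : tie_rule R).
Hypotheses (chi_gt1 : 1 < chi) (tie_ok : is_tie_rule tie).
Variables (n : nat) (theta : job_seq R n).
Hypothesis theta_ok : in_class 1 kappa theta.

Local Notation prio := (vprio (fun delta => chi `^ delta) theta).
Local Notation step := (step 1 (fun delta => chi `^ delta) tie theta).
Local Notation trace := (trace 1 (fun delta => chi `^ delta) tie theta).
Local Notation candidates :=
  (candidates (fun delta => chi `^ delta) tie theta).
Local Notation chosen := (chosen 1 (fun delta => chi `^ delta) tie theta).
Local Notation before := (before (fun delta => chi `^ delta) tie theta).
Local Notation completed_by_greedy :=
  (completed theta (greedy_alloc 1 (fun delta => chi `^ delta) tie theta)).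

Let chi_gt0 : 0 < chi. Proof. by apply: lt_trans chi_gt1. Qed.

Lemma demand1 i : demand (theta i) = 1%N.
Proof. by case: (theta_ok i) => _; case: (demand _) => [|[|]]. Qed.

Lemma len_ge1 i : 1 <= len (theta i).
Proof. by case: (theta_ok i) => _ _ /andP[]. Qed.

Lemma len_gt0 i : 0 < len (theta i).
Proof. by apply: lt_le_trans (len_ge1 i). Qed.

Lemma len_le i : len (theta i) <= kappa%:R.
Proof. by case: (theta_ok i) => _ _ /andP[]. Qed.

Lemma value_gt0 i : 0 < value (theta i).
Proof. by case: (theta_ok i). Qed.

Lemma release_ge0 i : 0 <= release (theta i).
Proof. by case: (theta_ok i). Qed.

Lemma next_criticalP (st : state R n) :
  match next_critical theta st with
  | Some t =>
    [/\ forall i, now st < release (theta i) -> t <= release (theta i),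
        forall i s, start st i = Some s -> t <= s + len (theta i)
      & (exists2 i, now st < release (theta i) & t = release (theta i)) \/
        (exists i s, start st i = Some s /\ t = s + len (theta i))]
  | None => (forall i, release (theta i) <= now st) /\
            (forall i, start st i = None)
  end.
Proof.
rewrite /next_critical; set l := _ ++ _; have := ohead_sortP R l.
have mem_release i : now st < release (theta i) -> release (theta i) \in l.
  move=> lti; rewrite mem_cat; apply/orP; left.
  by apply/mapP; exists i => //; rewrite mem_filter lti mem_enum.
have mem_end i s : start st i = Some s -> s + len (theta i) \in l.
  move=> si; rewrite mem_cat; apply/orP; right.
  rewrite mem_pmap; apply/mapP; exists i; rewrite ?mem_enum //.
  by rewrite si.
case: (ohead _) => [t [tl tmin]|l0]; last first.
  rewrite l0 in mem_release mem_end; split=> i.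
    by rewrite leNgt; apply/negP => /mem_release.
  by case E : (start st i) => [s|] //; have := mem_end _ _ E.
split=> [i /mem_release/tmin//|i s /mem_end/tmin//|].
move: tl; rewrite mem_cat => /orP[/mapP[i]|].
  by rewrite mem_filter => /andP[lti _] ->; left; exists i.
rewrite mem_pmap => /mapP[i _]; case E : (start st i) => [s|//] [->].
by right; exists i, s.
Qed.

Lemma before_total st t : total (before st t).
Proof.
case: tie_ok => tot _ _ i j; rewrite /before.
case: ltgtP => //= _; exact: tot.
Qed.

Lemma before_trans st t : transitive (before st t).
Proof.
case: tie_ok => _ _ tr j i k; rewrite /before.
move=> /orP[ij|/andP[/eqP ij tij]] /orP[jk|/andP[/eqP jk tjk]].
- by rewrite (lt_trans jk ij).
- by rewrite -jk ij.
- by rewrite ij jk.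
- by rewrite ij jk eqxx (tr _ _ _ tij tjk) orbT.
Qed.

Lemma before_prio st t i j : before st t i j -> prio st t j <= prio st t i.
Proof.
rewrite /before /rhoprio /vprio !demand1 !divr1.
by move=> /orP[/ltW|/andP[/eqP ->]].
Qed.

(** With two or more candidates, the second one overflows the capacity. The first has at least its
    priority by the sorting, so the branch that runs only the overflowing job changes nothing. *)
Lemma chosenE st t : chosen st t = take 1 (candidates st t).
Proof.
rewrite /chosen; have := sort_sorted (before_total st t)
  [seq i <- enum 'I_n | job_feasible theta st t i].
rewrite -/(candidates st t); case: (candidates st t) => [|x [|y s]] /= srt.
- by rewrite big_nil.
- by rewrite big_seq1 demand1.
rewrite /overflow /= !big_cons !demand1 big_nil add1n addn0 ltnn /=.
rewrite big_seq1 before_prio //.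
by case/andP: srt.
Qed.

Lemma mem_candidates st t i :
  (i \in candidates st t) = job_feasible theta st t i.
Proof. by rewrite mem_sort mem_filter mem_enum andbT. Qed.

Lemma chosenP st t :
  (chosen st t = [::] /\ forall i, ~~ job_feasible theta st t i) \/
  exists j, [/\ chosen st t = [:: j], job_feasible theta st t j
    & forall i, job_feasible theta st t i -> prio st t i <= prio st t j].
Proof.
rewrite chosenE; have := mem_candidates st t.
have := sort_sorted (before_total st t)
  [seq i <- enum 'I_n | job_feasible theta st t i].
rewrite -/(candidates st t); case: (candidates st t) => [|x s] /= srt mc.
  by left; split=> // i; rewrite -mc.
right; exists x; rewrite take0 -mc mem_head; split=> // i.
rewrite -mc inE => /predU1P[->//|si]; apply: before_prio.
by move: srt => /(order_path_min (@before_trans _ _))/allP/(_ _ si).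
Qed.

(** * Single steps of the mechanism and their invariant *)

Definition running (st : state R n) (i : 'I_n) : bool := start st i.

Lemma step_None st : next_critical theta st = None -> step st = st.
Proof. by rewrite /Defs.step => ->. Qed.

Lemma traceP k :
  (next_critical theta (trace k) = None /\ trace k.+1 = trace k) \/
  exists2 t, next_critical theta (trace k) = Some t
    & trace k.+1 = step (trace k).
Proof.
case nt : (next_critical theta (trace k)) => [t|]; [right|left].
  by exists t.
by split=> //; apply: step_None.
Qed.

Lemma stepP st t : next_critical theta st = Some t ->
  [/\ now (step st) = t, finished (step st) = finished_at theta st t
    & (forall i, ~~ running (step st) i /\ ~~ job_feasible theta st t i) \/
      exists j, [/\ job_feasible theta st t j,
        forall i, job_feasible theta st t i -> prio st t i <= prio st t j
      & forall i, start (step st) i =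
          if i == j then Some (odflt t (start st j)) else None]].
Proof.
rewrite /step => ->; split=> //.
have [[-> nf]|[j [-> jf jmax]]] := chosenP st t.
  by left => i; rewrite nf /running.
right; exists j; split=> // i /=; rewrite inE.
by case: eqP => // ->.
Qed.

(** The field [startable] is what the charging argument rests on: any job that could be started now
    is dominated by the running one. The field [finished_late] serves the lower bound, where a job
    just released must not count as finished. *)
Record invariant (st : state R n) : Prop := Invariant {
  running_uniq : forall i j, running st i -> running st j -> i = j;
  runningP : forall i s, start st i = Some s ->
    [/\ release (theta i) <= s, s <= now st, now st < s + len (theta i),
        s + len (theta i) <= deadline (theta i) & ~~ finished st i];
  startable : forall i, release (theta i) <= now st ->
    now st + len (theta i) <= deadline (theta i) -> ~~ finished st i ->
    exists2 j, running st j & value (theta i) <= prio st (now st) j;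
  finished_late : forall i, finished st i ->
    release (theta i) + len (theta i) <= now st }.

Lemma now_step st t : invariant st -> next_critical theta st = Some t ->
  now st < t.
Proof.
move=> st_ok; have := next_criticalP st => /[swap] -> [_ _ []].
  by move=> [i lti ->].
by move=> [i [s [/(runningP st st_ok)[_ _ ? _ _] ->]]].
Qed.

Lemma fraction_eq1 st t i s : start st i = Some s ->
  (fraction theta st t i == 1) = (t == s + len (theta i)).
Proof.
move=> si; rewrite /fraction si.
rewrite -[X in _ == X](divff (lt0r_neq0 (len_gt0 i))).
rewrite (inj_eq (divIf (lt0r_neq0 (len_gt0 i)))).
by rewrite subr_eq addrC.
Qed.

Lemma running_feasible st t i s : invariant st ->
  start st i = Some s -> now st <= t -> t < s + len (theta i) ->
  job_feasible theta st t i.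
Proof.
move=> st_ok si nt lt; have [ri sn _ di fi] := runningP st st_ok i s si.
rewrite /job_feasible /finished_at (fraction_eq1 st t i s) // (negPf fi).
rewrite (lt_eqF lt) andbF /= andbT (le_trans ri) ?(le_trans sn) //=.
rewrite /fraction si mulrBl mul1r divfK ?(lt0r_neq0 (len_gt0 i)) //; lra.
Qed.

Lemma fraction_ge0 st t i : invariant st -> now st <= t ->
  0 <= fraction theta st t i.
Proof.
move=> st_ok nt; rewrite /fraction; case si : (start st i) => [s|//].
have [_ sn _ _ _] := runningP st st_ok i s si.
by rewrite divr_ge0 ?(ltW (len_gt0 i)) // subr_ge0 (le_trans sn).
Qed.

(** A job started at [t] has fraction 0 both before and after the decision, and a job kept running
    retains its start time. *)
Lemma prio_step st t j : start (step st) j = Some (odflt t (start st j)) ->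
  prio (step st) t j = prio st t j.
Proof.
move=> sj; rewrite /vprio /fraction sj; case: (start st j) => //=.
by rewrite subrr mul0r.
Qed.

Lemma prio_le st t i : invariant st -> now st <= t ->
  value (theta i) <= prio st t i.
Proof.
move=> st_ok nt; rewrite /vprio -[leLHS]mulr1 ler_wpM2l ?(ltW (value_gt0 _)) //.
by rewrite -(powRr0 chi) ler_powR ?(ltW chi_gt1) ?fraction_ge0.
Qed.

Lemma invariant_step st : invariant st -> invariant (step st).
Proof.
move=> st_ok; case nt : (next_critical theta st) => [t|]; last first.
  by rewrite (step_None _ nt).
have ltt := now_step st t st_ok nt.
have := next_criticalP st; rewrite nt => -[trel tend _].
have [nowt fint dec] := stepP st t nt.
split.
- case: dec => [nr i j|[k [_ _ sk]] i j]; first by rewrite (negPf (nr i).1).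
  by rewrite /running !sk; case: eqP => // ->; case: eqP.
- move=> i s si; rewrite nowt fint.
  case: dec => [nr|[k [kf _ sk]]].
    by have := (nr i).1; rewrite /running si.
  move: si; rewrite sk; case: eqP => // -> [<-].
  case sk' : (start st k) => [s'|] /=.
    have [? ? ? ? fk] := runningP st st_ok k s' sk'.
    have ? := tend _ _ sk'.
    (* A job ending exactly at [t] is finished at [t], hence not feasible and not chosen; this makes
       the bound on [t] strict. *)
    have ne : (t == s' + len (theta k)) = false.
      move: kf; rewrite /job_feasible /finished_at (fraction_eq1 st t k s') //.
      by rewrite sk' /= => /and3P[_ _]; rewrite negb_or => /andP[_ /negPf].
    rewrite /finished_at (negPf fk) sk' (fraction_eq1 st t k s') // ne.
    have : t < s' + len (theta k) by rewrite lt_neqAle ne.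
    split=> //; lra.
  move: kf; rewrite /job_feasible /fraction sk' subr0 mul1r => /and3P[? ? ?].
  have := len_gt0 k; split=> //; lra.
- move=> i; rewrite nowt fint => ri di fi.
  (* Enough time to run from scratch is enough time to run the remaining fraction. *)
  have jf : job_feasible theta st t i.
    rewrite /job_feasible ri fi andbT /=.
    have := fraction_ge0 st t i st_ok (ltW ltt); have := len_gt0 i; nra.
  case: dec => [nr|[k [kf kmax sk]]].
    by have := (nr i).2; rewrite jf.
  exists k; first by rewrite /running sk eqxx.
  rewrite prio_step; last by rewrite sk eqxx.
  by apply: le_trans (kmax i jf); apply: prio_le => //; apply: ltW.
- move=> i; rewrite nowt fint /finished_at => /orP[|].
    by move/(finished_late st st_ok) => ?; lra.
  case si : (start st i) => [s|//].
  rewrite (fraction_eq1 st t i s) // => /eqP->.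
  by have [? _ _ _ _] := runningP st st_ok i s si; rewrite lerD2r.
Qed.

Lemma invariant_init : invariant (init R n).
Proof.
(* The initial clock is -1, so no job is released yet. *)
split=> // i /= ri; have := release_ge0 i; lra.
Qed.

Lemma invariant_trace k : invariant (trace k).
Proof.
elim: k => [|k]; first exact: invariant_init.
by rewrite /trace iterS; apply: invariant_step.
Qed.

(** This is one link of a preemption chain: a running job that does not end at [t] is still a
    candidate there, so the chosen job has at least its priority. *)
Lemma prio_step_max st t i s : invariant st ->
  next_critical theta st = Some t -> start st i = Some s ->
  t < s + len (theta i) ->
  exists2 j, start (step st) j = Some (odflt t (start st j))
    & prio st t i <= prio (step st) t j.
Proof.
move=> st_ok nt si lt; have [_ _ dec] := stepP st t nt.
have jf := running_feasible st t i s st_ok si (ltW (now_step st t st_ok nt)) lt.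
case: dec => [nr|[k [kf kmax sk]]].
  by have := (nr i).2; rewrite jf.
by exists k; rewrite ?prio_step ?kmax // sk eqxx.
Qed.

(** * The trace: monotonicity, termination and completed jobs *)

Lemma now_trace_le k : now (trace k) <= now (trace k.+1).
Proof.
have [[_ ->]//|[t nt ->]] := traceP k.
have [-> _ _] := stepP _ _ nt; apply: ltW; apply: now_step nt.
exact: invariant_trace.
Qed.

Lemma finished_trace_mono k k' i :
  (k <= k')%N -> finished (trace k) i -> finished (trace k') i.
Proof.
move=> /subnK <- fi; elim: (k' - k)%N => // d IH.
rewrite addSn; have [[_ ->]//|[t nt ->]] := traceP (d + k).
by have [_ -> _] := stepP _ _ nt; rewrite /finished_at IH.
Qed.

(** The number of jobs not yet released plus the number of unfinished jobs drops at every critical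
    time: a release lowers the first term, a completion the second. *)
Lemma trace_terminates : exists K, next_critical theta (trace K) = None.
Proof.
pose mu (st : state R n) := addn #|[pred i | now st < release (theta i)]|
  #|[pred i | ~~ finished st i]|.
suff H m : forall k, (mu (trace k) < m)%N ->
    exists K, next_critical theta (trace K) = None.
  by apply: (H (mu (trace 0)).+1 0).
elim: m => // m IH k lt; have st_ok := invariant_trace k.
have [[nt _]|[t nt sk]] := traceP k; first by exists k.
apply: (IH k.+1); rewrite -ltnS; apply: leq_trans lt; rewrite ltnS.
rewrite sk /mu.
have ltt := now_step _ _ st_ok nt.
have := next_criticalP (trace k); rewrite nt => -[_ _ cause].
have [-> -> _] := stepP _ _ nt.
have sub1 : [pred i | t < release (theta i)] \subset
            [pred i | now (trace k) < release (theta i)].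
  by apply/fintype.subsetP => i; rewrite !inE; apply: lt_trans.
have sub2 : [pred i | ~~ finished_at theta (trace k) t i] \subset
            [pred i | ~~ finished (trace k) i].
  by apply/fintype.subsetP => i; rewrite !inE negb_or => /andP[].
case: cause => [[i lti ti]|[i [s [si ti]]]].
  rewrite -addSn leq_add ?subset_leq_card // proper_card //.
  apply/properP; split=> //; exists i; rewrite !inE //.
  by rewrite ti ltxx.
rewrite -addnS leq_add ?subset_leq_card // proper_card //.
apply/properP; split=> //; exists i; rewrite !inE.
  by have [] := runningP _ st_ok i s si.
by rewrite negbK /finished_at si (fraction_eq1 _ _ _ _ si) ti eqxx orbT.
Qed.

Lemma trace_cover (t : R) : -1 <= t ->
  exists2 k, now (trace k) <= t
    & next_critical theta (trace k) = None \/ t < now (trace k.+1).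
Proof.
move=> t_ge; have [K HK] := trace_terminates.
have : now (trace K) <= t \/
       exists2 k, now (trace k) <= t & t < now (trace k.+1).
  elim: {HK} K => [|K [IH|IH]]; [by left| |by right].
  by case: (ltP t (now (trace K.+1))) => ?; [right; exists K|left].
case=> [?|[k ? ?]]; [by exists K; [|left] | by exists k; [|right]].
Qed.

Lemma released_at_trace k i : release (theta i) < now (trace k.+1) ->
  release (theta i) <= now (trace k).
Proof.
have [[_ ->] /ltW//|[t nt ->]] := traceP k.
have := next_criticalP (trace k); rewrite nt => -[trel _ _].
have [-> _ _] := stepP _ _ nt => lt; rewrite leNgt; apply/negP => /trel.
by rewrite leNgt lt.
Qed.

(** The run is followed back through the critical times. While [t] lies before the current one, the
    previous state has the same start time, since a run begun at the current time would start after
    [t]. *)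
Lemma greedy_alloc_running k i s t : start (trace k) i = Some s ->
  s <= t < now (trace k.+1) ->
  (demand (theta i) <=
   greedy_alloc 1 (fun delta => chi `^ delta) tie theta t i)%N.
Proof.
have E u : (exists k', (now (trace k') <= u < now (trace k'.+1)) /\
      running (trace k') i) -> (demand (theta i) <=
   greedy_alloc 1 (fun delta => chi `^ delta) tie theta u i)%N.
  by move=> ex; rewrite /greedy_alloc asboolT.
elim: k => [//|k IH] in s * => si /andP[st tn].
case: (leP (now (trace k.+1)) t) => [nt|tn'].
  by apply: E; exists k.+1; rewrite nt tn /running si.
have [[_ sk]|[t' nt sk]] := traceP k.
  by apply: (IH s); rewrite ?st // -sk.
have [nowt _ dec] := stepP _ _ nt.
move: dec => [nr|[j [_ _ sj]]].
  by have := (nr i).1; rewrite /running -sk si.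
move: si; rewrite sk sj.
case: eqP => // <- [E1].
case E2 : (start (trace k) i) E1 => [s'|] /= E1.
  by apply: (IH s'); rewrite // E1 st.
by move: tn'; rewrite sk nowt E1 ltNge st.
Qed.

Lemma finished_now k i : ~~ finished (trace k) i -> finished (trace k.+1) i ->
  exists2 s, start (trace k) i = Some s & now (trace k.+1) = s + len (theta i).
Proof.
have [[_ ->] /negPf-> //|[t nt ->]] := traceP k.
have [-> -> _] := stepP _ _ nt.
rewrite /finished_at => /negPf ->; case si : (start (trace k) i) => [s|//].
by rewrite (fraction_eq1 _ _ _ _ si) => /eqP; exists s.
Qed.

Lemma finished_completed k i : finished (trace k) i -> completed_by_greedy i.
Proof.
elim: k => [//|k IH] fi; case: (boolP (finished (trace k) i)) => [/IH//|nfi].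
have [s si nk] := finished_now k i nfi fi.
have [? _ _ ? _] := runningP _ (invariant_trace k) i s si.
exists s; split=> // t; rewrite -nk; exact: greedy_alloc_running.
Qed.

Lemma completed_running i : completed_by_greedy i ->
  exists s, [/\ release (theta i) <= s, s + len (theta i) <= deadline (theta i)
    & forall t, s <= t < s + len (theta i) ->
      exists2 k, now (trace k) <= t < now (trace k.+1) & running (trace k) i].
Proof.
move=> [s [rs sd al]]; exists s; split=> // t /al.
rewrite demand1 /greedy_alloc; case: asboolP => // -[k [? ?]] _.
by exists k.
Qed.

(** * Upper bound: preemption chains and charging *)

Let b := chi `^ (- (kappa%:R)^-1).

(** The form [k + d] provides the number [d] of remaining steps, on which [running_chain] is proved
    by induction. *)
Lemma trace_terminates_from k :
  exists d, next_critical theta (trace (k + d)) = None.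
Proof.
have [K HK] := trace_terminates; exists K; elim: k => // k.
by rewrite addSn; have [[nt ->]|[t -> _]] := traceP (k + K).
Qed.

Lemma prioE st t i s : start st i = Some s ->
  prio st t i = value (theta i) * chi `^ ((t - s) / len (theta i)).
Proof. by move=> si; rewrite /vprio /fraction si. Qed.

(** The fraction grows at rate [1 / len], which is at least [1 / kappa]. *)
Lemma prio_decay st i u t : running st i -> u <= t ->
  prio st u i <= prio st t i * b `^ (t - u).
Proof.
rewrite /running; case si : (start st i) => [s|//] _ ut.
rewrite !(prioE _ _ _ _ si) -mulrA ler_wpM2l ?(ltW (value_gt0 _)) //.
rewrite /b -powRrM -powRD_gt0 // ler_powR ?(ltW chi_gt1) //.
have -> : (u - s) / len (theta i) =
          (t - s) / len (theta i) - (t - u) / len (theta i) by ring.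
rewrite lerD2l mulNr lerN2 mulrC ler_wpM2l ?subr_ge0 //.
rewrite lef_pV2 ?posrE ?len_gt0 ?len_le //.
by apply: lt_le_trans (len_le i); apply: len_gt0.
Qed.

Lemma prio_mono st i u t : running st i -> u <= t ->
  prio st u i <= prio st t i.
Proof.
rewrite /running; case si : (start st i) => [s|//] _ ut.
rewrite !(prioE _ _ _ _ si) ler_wpM2l ?(ltW (value_gt0 _)) //.
by rewrite ler_powR ?(ltW chi_gt1) // ler_pM2r ?invr_gt0 ?len_gt0 // lerD2r.
Qed.

Lemma running_chain k j : running (trace k) j ->
  exists m k', [/\ ~~ finished (trace k') m, finished (trace k'.+1) m
    & forall t, t <= now (trace k.+1) ->
      t <= now (trace k'.+1) /\
      prio (trace k) t j <=
        chi * value (theta m) * b `^ (now (trace k'.+1) - t)].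
Proof.
have [d] := trace_terminates_from k.
elim: d k j => [|d IH] k j.
  rewrite addn0 => nt; have := next_criticalP (trace k); rewrite nt /running.
  by move=> [_ ->].
rewrite addnS -addSn => /IH{}IH rj.
have [[nt _]|[t nt sk]] := traceP k.
  have := next_criticalP (trace k); move: rj.
  by rewrite nt /running => + [_ nr]; rewrite nr.
have st_ok := invariant_trace k; have [nowt fint _] := stepP _ _ nt.
have := next_criticalP (trace k); rewrite nt => -[_ tend _].
have := rj; rewrite {1}/running; case sj : (start (trace k) j) => [s|//] _.
(* Either [j] ends at the next critical time, so that [m] is [j] with fraction 1, or it is still
   feasible there and the chain continues with the job then chosen. *)
have := tend _ _ sj; rewrite le_eqVlt => /predU1P[tE|lt].
  exists j, k; rewrite sk nowt fint.
  have [_ _ _ _ fj] := runningP _ st_ok j s sj; split=> //.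
    by rewrite /finished_at sj (fraction_eq1 _ _ _ _ sj) tE eqxx orbT.
  move=> u ut; split=> //; apply: le_trans (prio_decay _ _ _ _ rj ut) _.
  rewrite (prioE _ _ _ _ sj) tE addrC addKr divff ?lt0r_neq0 ?len_gt0 //.
  by rewrite powRr1 ?(ltW chi_gt0) // [chi * _]mulrC.
have [j' rj' pj'] := prio_step_max _ _ _ _ st_ok nt sj lt.
have {}rj' : running (trace k.+1) j' by rewrite /running sk rj'.
have [m [k' [nfm fm chain]]] := IH _ rj'; exists m, k'; split=> // u.
have [te pm] := chain (now (trace k.+1)) (now_trace_le _).
rewrite sk nowt in te pm *; move=> ut; split; first exact: le_trans te.
apply: le_trans (prio_decay _ _ _ _ rj ut) _.
(* The decay of [j] from [t] back to [u] multiplies the bound that the rest of the chain gives at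
   [t]. *)
have -> : now (trace k'.+1) - u = (now (trace k'.+1) - t) + (t - u) by ring.
rewrite (powRD_gt0 _ b (_ - _)) ?powR_gt0 // mulrA ler_wpM2r ?powR_ge0 //.
exact: le_trans pm.
Qed.

(* The deadline allows starting [i] at the last critical time before [s], so
   the job chosen then has priority at least that of [i]. *)
Lemma unfinished_charge i s :
  release (theta i) <= s -> s + len (theta i) <= deadline (theta i) ->
  (forall k, ~~ finished (trace k) i) ->
  exists m k, [/\ ~~ finished (trace k) m, finished (trace k.+1) m,
    s <= now (trace k.+1)
    & value (theta i) <=
        chi * value (theta m) * b `^ (now (trace k.+1) - s)].
Proof.
move=> rs sd fi; have r0 := release_ge0 i.
have [k ks ksP] : exists2 k, now (trace k) <= s &
    next_critical theta (trace k) = None \/ s < now (trace k.+1).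
  by apply: trace_cover; lra.
have rk : release (theta i) <= now (trace k).
  case: ksP => [nt|lt]; last by apply: released_at_trace; apply: le_lt_trans lt.
  by have := next_criticalP (trace k); rewrite nt => -[].
have [|j rj vj] := startable _ (invariant_trace k) i rk _ (fi k).
  by apply: le_trans sd; rewrite lerD2r.
case: ksP => [nt|/ltW sk].
  have := next_criticalP (trace k); move: rj.
  by rewrite nt /running => + [_ nr]; rewrite nr.
have [m [k' [nfm fm /(_ s sk)[se pm]]]] := running_chain k j rj.
exists m, k'; split=> //; apply: le_trans vj _.
by apply: le_trans pm; apply: prio_mono.
Qed.

(** It makes all jobs charged to the same [m] refer to the same completion time. *)
Lemma finished_step_uniq i k k' :
  ~~ finished (trace k) i -> finished (trace k.+1) i ->
  ~~ finished (trace k') i -> finished (trace k'.+1) i -> k = k'.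
Proof.
move=> /negP nfk fk /negP nfk' fk'; case: (ltngtP k k') => // lt.
  by case: nfk'; apply: finished_trace_mono lt fk.
by case: nfk; apply: finished_trace_mono lt fk'.
Qed.

(** Otherwise both jobs would hold the only instance at time [sj]. *)
Lemma alloc_feasible_spaced (a : allocation R n) i j si sj :
  alloc_feasible 1 a -> i != j -> 0 <= si -> si <= sj ->
  (forall t, si <= t < si + len (theta i) -> (demand (theta i) <= a t i)%N) ->
  (forall t, sj <= t < sj + len (theta j) -> (demand (theta j) <= a t j)%N) ->
  si + len (theta i) <= sj.
Proof.
move=> fa ij s0 sij ai aj; rewrite leNgt; apply/negP => lt.
have /ai : si <= sj < si + len (theta i) by rewrite sij.
have /aj : sj <= sj < sj + len (theta j) by rewrite lexx ltrDl len_gt0.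
have := fa sj (le_trans s0 sij).
rewrite !demand1 (bigD1 i) //= (bigD1 j) 1?eq_sym //=; lia.
Qed.

Hypothesis kappa_gt0 : (0 < kappa)%N.

Lemma decay_factor_itv : 0 < b < 1.
Proof.
rewrite powR_gt0 //= -(powRr0 chi) ltr_powR_base_gt1 // oppr_lt0.
by rewrite invr_gt0 ltr0n.
Qed.

Lemma welfare_le (a : allocation R n) : alloc_feasible 1 a ->
  welfare theta a <= (chi / (1 - b) + 1) *
    welfare theta (greedy_alloc 1 (fun delta => chi `^ delta) tie theta).
Proof.
move=> fa; pose fin i := `[< exists k, finished (trace k) i >].
pose F := \sum_(i | fin i) value (theta i).
have /andP[b0 b1] := decay_factor_itv; have v0 i := ltW (value_gt0 i).
have F_le : F <= welfare theta
    (greedy_alloc 1 (fun delta => chi `^ delta) tie theta).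
  rewrite /F /welfare big_mkcond [leRHS]big_mkcond; apply: ler_sum => i _.
  case: ifPn => [/asboolP[k fk]|_]; last by case: ifP.
  by rewrite asboolT //; apply: finished_completed fk.
suff : welfare theta a <= (chi / (1 - b) + 1) * F.
  move=> /le_trans; apply; rewrite ler_wpM2l // addr_ge0 // divr_ge0 ?ltW //.
  by rewrite subr_gt0.
(* The offline jobs that the mechanism also finishes weigh at most [F]; the others are charged to
   jobs in [fin]. *)
rewrite /welfare (bigID fin) /= mulrDl mul1r addrC; apply: lerD; last first.
  rewrite /F big_mkcond [leRHS]big_mkcond; apply: ler_sum => i _.
  by case: (fin i); rewrite ?andbT ?andbF //; case: ifP.
(* A charge of [i] consists of its offline start, the job charged, and the index of the step in
   which that job finishes. *)
pose charged i (p : R * 'I_n * nat) :=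
  [/\ 0 <= p.1.1, forall t, p.1.1 <= t < p.1.1 + len (theta i) ->
      (demand (theta i) <= a t i)%N,
    ~~ finished (trace p.2) p.1.2 /\ finished (trace p.2.+1) p.1.2,
    p.1.1 <= now (trace p.2.+1)
    & value (theta i) <=
        chi * value (theta p.1.2) * b `^ (now (trace p.2.+1) - p.1.1)].
have /choice[g gP] : forall i, exists p,
    `[< completed theta a i >] && ~~ fin i -> charged i p.
  (* Jobs that need no charge receive a dummy triple. *)
  move=> i; case: (boolP (_ && _)) => [|_]; last by exists (0, i, 0%N).
  move=> /andP[/asboolP[s [rs sd al]] /asboolPn nf].
  have [|m [k [? ? ? ?]]] := unfinished_charge i s rs sd.
    by move=> k; apply/negP => fk; apply: nf; exists k.
  exists (s, m, k) => _; split=> //=.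
  by apply: le_trans rs; apply: release_ge0.
rewrite (partition_big (fun i => (g i).1.2) fin) /=; last first.
  by move=> i /gP[_ _ [_ fk] _ _]; apply/asboolP; exists (g i).2.+1.
rewrite /F mulr_sumr; apply: ler_sum => m fm.
pose A := [set i | (`[< completed theta a i >] && ~~ fin i) &&
                   ((g i).1.2 == m)].
pose x i := now (trace (g i).2.+1) - (g i).1.1.
have AP i : i \in A -> charged i (g i) /\ (g i).1.2 = m.
  by rewrite inE => /andP[/gP ? /eqP].
have -> : \sum_(i | `[< completed theta a i >] && ~~ fin i && ((g i).1.2 == m))
    value (theta i) = \sum_(i in A) value (theta i).
  by apply: eq_bigl => i; rewrite inE.
apply: (@le_trans _ _ (chi * value (theta m) * \sum_(i in A) b `^ x i)).
  rewrite mulr_sumr; apply: ler_sum => i /AP[[_ _ _ _ +] mE].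
  by rewrite mE.
(* The exponents [x i] are nonnegative, so the spaced sum is bounded with lower end 0. *)
have -> : chi / (1 - b) * value (theta m) =
          chi * value (theta m) * (b `^ 0 / (1 - b)).
  by rewrite powRr0; ring.
rewrite ler_wpM2l ?mulr_ge0 ?(ltW chi_gt0) ?v0 //.
apply: sum_spaced_powR; rewrite ?b0 //.
  by move=> i /AP[[_ _ _ ? _] _]; rewrite subr_ge0.
move=> i j /AP[[si ai [nfi fi] _ _] mi] /AP[[sj aj [nfj fj] _ _] mj] ij.
(* With a common completion time, the exponents differ exactly as the offline starts do, hence by at
   least one job length. *)
have -> : x i = now (trace (g j).2.+1) - (g i).1.1.
  rewrite /x; suff -> : (g i).2 = (g j).2 by [].
  rewrite mi in nfi fi; rewrite mj in nfj fj.
  exact: finished_step_uniq nfi fi nfj fj.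
have := len_ge1 i; have := len_ge1 j; rewrite /x.
have [sij|/ltW sji] := leP (g i).1.1 (g j).1.1.
  have := alloc_feasible_spaced a i j _ _ fa ij si sij ai aj.
  by right; lra.
have := alloc_feasible_spaced a j i _ _ fa _ sj sji aj ai.
by rewrite eq_sym => /(_ ij); left; lra.
Qed.

Lemma OPT_le : OPT theta 1 <= (chi / (1 - b) + 1) *
  welfare theta (greedy_alloc 1 (fun delta => chi `^ delta) tie theta).
Proof.
apply: ge_sup; last by move=> _ [a fa ->]; apply: welfare_le.
exists (welfare theta (fun _ _ => 0%N)), (fun _ _ => 0%N) => // t _.
by rewrite big1.
Qed.

End UnitCapacityGreedy.

Arguments running {R n} st i.

(** * Lower bound: the hard instance and the run of the mechanism on it *)

Lemma nat_itv_uniq (R : realType) (m k : nat) (t : R) :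
  m%:R <= t < m%:R + 1 -> k%:R <= t < k%:R + 1 -> m = k.
Proof.
move=> /andP[mt tm] /andP[kt tk]; apply/eqP.
by rewrite eqn_leq -[(m <= k)%N]ltnS -[(k <= m)%N]ltnS -!(ltr_nat R) -!natr1
  (le_lt_trans mt tk) (le_lt_trans kt tm).
Qed.

Section HardInstance.
Variables (R : realType) (kappa : nat) (chi : R) (tie : tie_rule R).
Hypotheses (kappa_gt0 : (0 < kappa)%N) (chi_gt1 : 1 < chi).
Hypothesis tie_ok : is_tie_rule tie.
Variables (M : nat) (eps gamma : R).
Hypotheses (eps_gt0 : 0 < eps) (eps_lt1 : M.+1%:R * eps < 1).
Hypothesis eps_lt_gamma : M.+1%:R * eps < gamma.

(* [eps] makes consecutive releases [1 - eps] apart, which is less than a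
   blocker's length even when [kappa = 1]; still, blocker [i] is released
   between the integer times [i] and [i + 1]. *)
Definition blocker_release (i : nat) : R :=
  i%:R + (M.+1%:R - i%:R) * eps.

(* Only blocker [M] has slack: the offline schedule runs it after all the
   victims. *)
Definition blocker (i : nat) : job R :=
  Job (blocker_release i)
    (if i == M then (M + kappa).+1%:R + kappa%:R
     else blocker_release i + kappa%:R)
    1 kappa%:R (chi `^ (i%:R / kappa%:R)).

(* The victim of index [j] is the one released at time [j + 1]; the factor
   [chi ^ (- gamma)] puts its value below the current blocker's priority. *)
Definition victim (j : nat) : job R :=
  Job j.+1%:R (j.+1%:R + 1) 1 1 (chi `^ (j.+1%:R / kappa%:R - gamma)).

Definition hard_seq : job_seq R (M.+1 + (M + kappa)) := fun i =>
  match fintype.split i with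
  | inl i => blocker i
  | inr j => victim j
  end.

Let blk (i : 'I_M.+1) : 'I_(M.+1 + (M + kappa)) := lshift (M + kappa) i.
Let vic (j : 'I_(M + kappa)) : 'I_(M.+1 + (M + kappa)) := rshift M.+1 j.

Local Notation prio := (vprio (fun delta => chi `^ delta) hard_seq).
Local Notation trace := (trace 1 (fun delta => chi `^ delta) tie hard_seq).
Local Notation greedy :=
  (greedy_alloc 1 (fun delta => chi `^ delta) tie hard_seq).

Let chi_gt0 : 0 < chi. Proof. by apply: lt_trans chi_gt1. Qed.

Let kappaR_ge1 : 1 <= kappa%:R :> R. Proof. by rewrite ler1n. Qed.

Lemma hard_seq_blocker i : hard_seq (blk i) = blocker i.
Proof. by rewrite /hard_seq (unsplitK (inl i)). Qed.

Lemma hard_seq_victim j : hard_seq (vic j) = victim j.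
Proof. by rewrite /hard_seq (unsplitK (inr j)). Qed.

Lemma hard_seqP i : (exists i', i = blk i') \/ (exists j, i = vic j).
Proof. by case: (split_ordP i) => j ->; [left|right]; exists j. Qed.

Lemma eps_below1 : eps < 1.
Proof.
apply: le_lt_trans eps_lt1; rewrite -[leLHS]mul1r ler_wpM2r ?(ltW eps_gt0) //.
by rewrite ler1n.
Qed.

Lemma blocker_releaseB i i' :
  blocker_release i' - blocker_release i = (i'%:R - i%:R) * (1 - eps).
Proof. by rewrite /blocker_release; ring. Qed.

Lemma blocker_release_itv (i : 'I_M.+1) :
  i%:R < blocker_release i <= i%:R + M.+1%:R * eps.
Proof.
have iM : 0 < (M.+1%:R - i%:R) * eps.
  by rewrite mulr_gt0 // subr_gt0 ltr_nat ltn_ord.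
have i0 : 0 <= i%:R * eps by rewrite mulr_ge0 // ltW.
by rewrite /blocker_release; apply/andP; split; lra.
Qed.

Lemma blocker_release_le (i i' : nat) :
  (i <= i')%N -> blocker_release i <= blocker_release i'.
Proof.
rewrite -(ler_nat R) => ii; rewrite -subr_ge0 blocker_releaseB.
by rewrite mulr_ge0 ?subr_ge0 ?(ltW eps_below1).
Qed.

Lemma hard_seq_in_class : in_class 1 kappa hard_seq.
Proof.
move=> i; case: (hard_seqP i) => [[i' ->]|[j ->]].
  rewrite hard_seq_blocker; have /andP[i'b _] := blocker_release_itv i'.
  split=> //=; [|by rewrite kappaR_ge1 lexx|exact: powR_gt0].
  by apply: le_trans (ltW i'b).
rewrite hard_seq_victim; split=> //=; last exact: powR_gt0.
by rewrite lexx kappaR_ge1.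
Qed.

Let inv k := invariant_trace R kappa chi tie chi_gt1 tie_ok _ hard_seq
  hard_seq_in_class k.

Lemma prio_blocker st t i s : start st (blk i) = Some s ->
  prio st t (blk i) = chi `^ ((i%:R + (t - s)) / kappa%:R).
Proof.
move=> si; rewrite (prioE _ _ _ _ _ _ _ _ si) hard_seq_blocker /=.
by rewrite -powRD_gt0 // -mulrDl.
Qed.

Lemma prio_victim st t j s : start st (vic j) = Some s ->
  prio st t (vic j) = chi `^ (j.+1%:R / kappa%:R - gamma + (t - s)).
Proof.
move=> si; rewrite (prioE _ _ _ _ _ _ _ _ si) hard_seq_victim /=.
by rewrite divr1 -powRD_gt0.
Qed.

(** A victim has no slack, so its run can only begin at its release. *)
Lemma victim_startP st j s :
  invariant R chi _ hard_seq st -> start st (vic j) = Some s ->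
  s = j.+1%:R /\ j.+1%:R <= now st < j.+1%:R + 1.
Proof.
move=> st_ok sj; have [] := runningP _ _ _ _ _ st_ok _ _ sj.
rewrite hard_seq_victim /= => rs sn ns sd _.
have sE : s = j.+1%:R by apply/eqP; rewrite eq_le rs andbT; lra.
by split=> //; rewrite -sE sn ns.
Qed.

(** By [startable] some running job has priority at least [chi ^ (i / kappa)]. An earlier blocker
    [i'] has gained only [(i - i') * (1 - eps)] units of time and stays below. A running victim must
    be the one released at time [i]; it has run for less than [gamma], so it stays below too. *)
Lemma blocker_starts st (i : 'I_M.+1) : invariant R chi _ hard_seq st ->
  now st = blocker_release i ->
  start st (blk i) = Some (blocker_release i).
Proof.
move=> st_ok nowE; have /andP[bi1 bi2] := blocker_release_itv i.
have [|||j] := startable _ _ _ _ _ st_ok (blk i).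
- by rewrite hard_seq_blocker nowE.
- rewrite hard_seq_blocker nowE /=; case: eqP => // ->.
  have := blocker_release_itv ord_max => /= /andP[_ ?].
  by rewrite lerD2r -natr1 natrD; have := kappaR_ge1; have := eps_lt1; lra.
- apply/negP => /(finished_late _ _ _ _ _ st_ok).
  by rewrite hard_seq_blocker nowE /=; have := kappaR_ge1; lra.
rewrite hard_seq_blocker /= /running; case sj : (start st j) => [s|//] _.
rewrite leNgt => /negP vj; case: (hard_seqP j) => [[i' jE]|[v jE]].
- rewrite jE in sj vj; have [] := runningP _ _ _ _ _ st_ok _ _ sj.
  rewrite hard_seq_blocker nowE /= => rs sn _ _ _.
  have [lt|lt|/val_inj ii] := ltngtP i i'; first 1 last.
  + case: vj; rewrite (prio_blocker _ _ _ _ sj) ltr_powR_base_gt1 //.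
    rewrite ltr_pM2r ?invr_gt0 ?ltr0n // nowE.
    move: rs; rewrite -(lerD2l (- blocker_release i)).
    have := blocker_releaseB i i'.
    by move: lt; rewrite -(ltr_nat R) => lt; have := eps_gt0; nra.
  + by rewrite ii sj in sn *; congr Some; apply/eqP; rewrite eq_le sn rs.
  + exfalso; have := blocker_releaseB i i'; have := eps_below1.
    by move: lt; rewrite -(ltr_nat R) => lt; nra.
rewrite jE in sj vj; have [sE] := victim_startP _ _ _ st_ok sj.
rewrite nowE => /andP[vb bv]; have e1 := eps_lt1; have eg := eps_lt_gamma.
have vi : v.+1 = i.
  apply: (@nat_itv_uniq R _ _ (blocker_release i)); first by rewrite vb.
  by apply/andP; split; lra.
case: vj; rewrite (prio_victim _ _ _ _ sj) ltr_powR_base_gt1 // sE nowE vi.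
lra.
Qed.

Lemma blocker_runs k (i : 'I_M.+1) :
  blocker_release i <= now (trace k) < blocker_release i + kappa%:R ->
  ((i < M)%N -> now (trace k) < blocker_release i.+1) ->
  start (trace k) (blk i) = Some (blocker_release i).
Proof.
have /andP[bi1 bi2] := blocker_release_itv i.
elim: k => [/andP[lt _]|k IH].
  by exfalso; have : 0 <= i%:R :> R by []; move: lt => /=; lra.
have [[_ ->]//|[t nt sk]] := traceP R chi tie _ hard_seq k.
have st_ok := inv k; have st_ok' := inv k.+1; rewrite sk in st_ok'.
have [nowt _ _] := stepP _ _ chi _ tie_ok _ _ hard_seq_in_class _ _ nt.
have ltt := now_step _ _ _ _ _ _ st_ok nt.
rewrite sk nowt => /andP[bt tb] tnext.
(* Either this step is the release of blocker [i], or the blocker was already running and must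
   survive the decision at [t]. *)
case: (ltP (now (trace k)) (blocker_release i)) => [lt|le].
  apply: blocker_starts => //; rewrite nowt; apply/eqP; rewrite eq_le bt andbT.
  have := next_criticalP _ _ hard_seq (trace k); rewrite nt => -[+ _ _].
  by move/(_ (blk i)); rewrite hard_seq_blocker; apply.
have si : start (trace k) (blk i) = Some (blocker_release i).
  apply: IH => [|/tnext]; last exact: lt_trans.
  by rewrite le (lt_trans ltt).
have [|j sj pj] := prio_step_max _ _ _ _ tie_ok _ _ hard_seq_in_class
  _ _ _ _ st_ok nt si.
  by rewrite hard_seq_blocker.
have [jE|/eqP ij] := eqVneq j (blk i); first by rewrite -jE sj jE si.
have sjN : start (trace k) j = None.
  case E : (start (trace k) j) => [s|//]; case: ij.
  by apply: (running_uniq _ _ _ _ _ st_ok); rewrite /running ?E ?si.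
(* A job displacing the blocker would start at [t] with fraction 0. A blocker of index at most [i]
   is then worth too little, and a later one is not yet released. A victim is worth
   [chi ^ (t / kappa - gamma)], while the running blocker lags behind [chi ^ (t / kappa)] by an
   exponent smaller than [gamma]. *)
rewrite sjN /= in sj; exfalso; move: pj; apply/negP; rewrite -ltNge.
case: (hard_seqP j) => [[i' jE]|[v jE]]; rewrite {}jE in sj ij *.
  rewrite (prio_blocker _ _ _ _ sj) (prio_blocker _ _ _ _ si).
  apply: ltr_powR_base_gt1 => //; rewrite ltr_pM2r ?invr_gt0 ?ltr0n //.
  have [] := runningP _ _ _ _ _ st_ok' _ _ sj.
  rewrite hard_seq_blocker nowt /= => rt _ _ _ _.
  have [le'|lt'] := leqP i' i.
    by move: le'; rewrite -(ler_nat R); lra.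
  have iM : (i < M)%N by apply: leq_trans lt' _; rewrite -ltnS ltn_ord.
  by have := tnext iM; have := blocker_release_le _ _ lt'; lra.
have [tE _] := victim_startP _ _ _ st_ok' sj.
rewrite (prio_victim _ _ _ _ sj) (prio_blocker _ _ _ _ si).
apply: ltr_powR_base_gt1 => //; rewrite subrr addr0 -tE.
have -> : (i%:R + (t - blocker_release i)) / kappa%:R =
  t / kappa%:R - (blocker_release i - i%:R) / kappa%:R by ring.
rewrite ltrD2l ltrN2 ltr_pdivrMr ?ltr0n //.
have gamma0 : 0 < gamma by apply: lt_trans eps_lt_gamma; rewrite mulr_gt0.
have : gamma <= gamma * kappa%:R by rewrite ler_peMr // ltW.
have := eps_lt_gamma; lra.
Qed.

(** A release time is critical, so the state covering [t] was decided at [t] itself and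
    [blocker_runs] applies. *)
Lemma blocker_running_at (i : 'I_M.+1) (t : R) :
  blocker_release i <= t < blocker_release i + kappa%:R ->
  ((i < M)%N -> t < blocker_release i.+1) ->
  forall j, t = release (hard_seq j) ->
  forall k, now (trace k) <= t < now (trace k.+1) ->
  running (trace k) (blk i).
Proof.
move=> ti tnext j tj k /andP[kt tk].
have tE : now (trace k) = t.
  apply/eqP; rewrite eq_le kt tj.
  apply: (released_at_trace _ _ _ _ tie_ok _ _ hard_seq_in_class).
  by rewrite -tj.
by rewrite /running blocker_runs ?tE.
Qed.

(** Completing any other job would require it to run at a release time at which a different blocker
    runs: for a blocker, the release of its successor; for a victim, its own release. *)
Lemma only_last_blocker_completed j :
  completed hard_seq greedy j -> j = blk ord_max.
Proof.
move=> /(completed_running _ _ _ _ _ _ hard_seq_in_class)[s [rs sd run]].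
have uniq k i : running (trace k) j -> running (trace k) (blk i) ->
    j = blk i.
  by apply: running_uniq (inv k) _ _.
case: (hard_seqP j) => [[i jE]|[v jE]]; subst j.
  have [->//|iM] := eqVneq i ord_max.
  have lt : (i < M)%N.
    by rewrite ltn_neqAle -ltnS ltn_ord andbT; apply: contraNneq iM => /eqP.
  rewrite hard_seq_blocker /= (ltn_eqF lt) in rs sd run.
  have i1 : (i.+1 < M.+1)%N by [].
  pose i' := Ordinal i1; have d := blocker_releaseB i i.+1.
  have [|k kt rk] := run (blocker_release i.+1).
    have e0 := eps_gt0; have e1 := eps_below1; have k1 := kappaR_ge1.
    by rewrite -natr1 in d; apply/andP; split; lra.
  have : blk i = blk i'.
    apply: (uniq k) => //; apply: (blocker_running_at i' _ _ _ (blk i') _ k kt).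
    - by rewrite lexx ltrDl ltr0n.
    - move=> _; rewrite -subr_gt0 blocker_releaseB -natr1 addrAC subrr add0r.
      by rewrite mul1r subr_gt0 eps_below1.
    - by rewrite hard_seq_blocker.
  by move=> /(congr1 val) /= /n_Sn.
rewrite hard_seq_victim /= in rs sd run.
have [|k kt rk] := run v.+1%:R; first by apply/andP; split; lra.
(* Blocker [v] is released before time [v + 1] and its successor after it; once the blockers are
   exhausted, blocker [M] keeps running up to the last victim. *)
pose i : 'I_M.+1 := inord (minn v M).
have iE : i = minn v M :> nat by rewrite inordK // ltnS geq_minr.
have : vic v = blk i.
  apply: (uniq k) => //; apply: (blocker_running_at i _ _ _ (vic v) _ k kt).
  - have /andP[bi1 bi2] := blocker_release_itv i.
    have iv : i%:R <= v%:R :> R by rewrite ler_nat iE geq_minl.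
    have vi : v.+1%:R <= i%:R + kappa%:R :> R.
      rewrite -natrD ler_nat iE /minn.
      case: (ltnP v M) => _; last exact: ltn_ord.
      by rewrite -addn1 leq_add2l.
    have e1 := eps_lt1.
    by rewrite -natr1 in vi *; apply/andP; split; lra.
  - move=> lt; have -> : v = i :> nat
      by move: lt; rewrite iE gtn_min ltnn orbF => /ltnW/minn_idPl ->.
    by have /andP[] := blocker_release_itv (Ordinal (lt : (i.+1 < M.+1)%N)).
  - by rewrite hard_seq_victim.
by move=> /eqP; rewrite eq_sym eq_lrshift.
Qed.

Lemma welfare_greedy_le : welfare hard_seq greedy <= chi `^ (M%:R / kappa%:R).
Proof.
rewrite /welfare big_mkcond.
apply: (@le_trans _ _
  (\sum_i if i == blk ord_max then value (hard_seq i) else 0)).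
  apply: ler_sum => i _; case: asboolP => [/only_last_blocker_completed ->|_].
    by rewrite eqxx.
  by case: ifP => // _; apply: ltW; case: (hard_seq_in_class i).
by rewrite -big_mkcond big_pred1_eq hard_seq_blocker.
Qed.

(** * The offline schedule of the hard instance and its welfare *)

Definition selected (i : 'I_(M.+1 + (M + kappa))) : bool :=
  if fintype.split i is inl i' then i' == ord_max else true.

(** The last victim is released at [M + kappa] and ends one unit later, when blocker [M] begins. For
    the other blockers the value is a default masked by [selected]. *)
Definition opt_start (i : 'I_(M.+1 + (M + kappa))) : R :=
  if fintype.split i is inr j then j.+1%:R else (M + kappa).+1%:R.

Definition opt_alloc : allocation R (M.+1 + (M + kappa)) := fun t i =>
  selected i && (opt_start i <= t < opt_start i + len (hard_seq i)) : nat.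

Lemma opt_alloc_feasible : alloc_feasible 1 opt_alloc.
Proof.
move=> t _.
have uniq i j : (0 < opt_alloc t i)%N -> (0 < opt_alloc t j)%N -> i = j.
  rewrite /opt_alloc !lt0b /selected /opt_start /hard_seq.
  case: (split_ordP i) => i' ->; case: (split_ordP j) => j' -> /=.
  - by move=> /andP[/eqP-> _] /andP[/eqP-> _].
  - move=> /and3P[_ it _] /andP[_ tj].
    (* Victim [j'] ends at [j' + 2], no later than blocker [M] starts. *)
    have H : j'.+2%:R <= (M + kappa).+1%:R :> R by rewrite ler_nat ltnS.
    by exfalso; rewrite -[j'.+2%:R]natr1 in H; lra.
  - move=> /andP[_ tj] /and3P[_ it _].
    have H : i'.+2%:R <= (M + kappa).+1%:R :> R by rewrite ler_nat ltnS.
    by exfalso; rewrite -[i'.+2%:R]natr1 in H; lra.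
  - move=> it jt; congr rshift; apply/val_inj/succn_inj.
    exact: nat_itv_uniq it jt.
have [/existsP[i ai]|] := boolP [exists i, 0 < opt_alloc t i]%N.
  rewrite (bigD1 i) //= big1 ?addn0 ?leq_b1 // => j; apply: contraNeq.
  by rewrite -lt0n => aj; apply/eqP; apply: uniq.
rewrite negb_exists => /forallP na; rewrite big1 // => i _.
by apply/eqP; rewrite -leqn0 leqNgt na.
Qed.

Lemma selected_completed i : selected i -> completed hard_seq opt_alloc i.
Proof.
move=> si; exists (opt_start i).
suff [rs sd dem] : [/\ release (hard_seq i) <= opt_start i,
    opt_start i + len (hard_seq i) <= deadline (hard_seq i)
    & demand (hard_seq i) = 1%N].
  by split=> // t ti; rewrite dem /opt_alloc si ti.
move: si; rewrite /selected /opt_start /hard_seq.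
case: (split_ordP i) => i' _ /=; last by [].
move=> /eqP ->; rewrite eqxx; split=> //.
have /andP[_ /= bM] := blocker_release_itv ord_max.
have e1 := eps_lt1; have k1 := kappaR_ge1.
by rewrite -natr1 natrD /=; lra.
Qed.

Let b := chi `^ (- (kappa%:R)^-1).

(** Multiplying by [b] lowers the exponent by [1 / kappa], so consecutive terms cancel. *)
Lemma sum_powR_telescope N :
  (1 - b) * \sum_(j < N) chi `^ (j.+1%:R / kappa%:R) =
  chi `^ (N%:R / kappa%:R) - 1.
Proof.
elim: N => [|N IH]; first by rewrite big_ord0 mulr0 mul0r powRr0 subrr.
rewrite big_ord_recr mulrDr IH /= mulrBl mul1r /b -powRD_gt0 //.
have -> : - kappa%:R^-1 + N.+1%:R / kappa%:R = N%:R / kappa%:R :> R.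
  by rewrite -natr1; ring.
by ring.
Qed.

Lemma OPT_hard_ge :
  chi `^ (M%:R / kappa%:R) + chi `^ (- gamma) *
    \sum_(j < M + kappa) chi `^ (j.+1%:R / kappa%:R) <= OPT hard_seq 1.
Proof.
apply: (@le_trans _ _ (welfare hard_seq opt_alloc)); last first.
  apply: ub_le_sup; last by exists opt_alloc => //; apply: opt_alloc_feasible.
  exists (\sum_i value (hard_seq i)) => _ [a _ ->].
  rewrite /welfare big_mkcond; apply: ler_sum => i _; case: ifP => // _.
  by apply: ltW; case: (hard_seq_in_class i).
apply: (@le_trans _ _ (\sum_(i | selected i) value (hard_seq i))); last first.
  rewrite /welfare big_mkcond [leRHS]big_mkcond; apply: ler_sum => i _.
  case: ifPn => [/selected_completed ci|_]; first by rewrite asboolT.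
  by case: ifP => // _; apply: ltW; case: (hard_seq_in_class i).
rewrite [leRHS]big_split_ord /=; apply: lerD.
  rewrite (bigD1 ord_max) /=; last by rewrite /selected (unsplitK (inl _)).
  rewrite [hard_seq _]hard_seq_blocker /= lerDl sumr_ge0 // => i _.
  by apply: ltW; case: (hard_seq_in_class (blk i)).
rewrite mulr_sumr [leRHS]big_mkcond; apply: ler_sum => j _.
rewrite /selected (unsplitK (inr _)) [hard_seq _]hard_seq_victim /=.
by rewrite -powRD_gt0 // addrC.
Qed.

End HardInstance.

(** * Choice of the parameters and the final estimate *)

Lemma powR_onto01 (R : realType) (chi y : R) : 1 < chi -> 0 < y < 1 ->
  exists2 g, 0 < g & chi `^ (- g) = y.
Proof.
move=> chi1 /andP[y0 y1]; have lnchi : 0 < ln chi by rewrite ln_gt0.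
exists (- ln y / ln chi).
  by rewrite divr_gt0 // oppr_gt0 -ln1 ltr_ln ?posrE.
rewrite /powR gt_eqF ?(lt_trans _ chi1) //.
by rewrite !mulNr opprK divfK ?gt_eqF // lnK ?posrE.
Qed.

Theorem theorem3p6 (R : realType) (kappa : nat) (chi : R) (tie : tie_rule R)
    (kappa_ge1 : (1 <= kappa)%N) (chi_gt1 : 1 < chi)
    (tie_ok : is_tie_rule tie) :
  is_competitive_ratio 1 1 kappa
    (GammaG 1 (fun delta : R => chi `^ delta) tie)
    (chi / (1 - chi `^ (- (kappa%:R)^-1)) + 1).
Proof.
have chi_gt0 : 0 < chi by lra.
split=> [n theta theta_ok|c' comp].
  apply/negP; rewrite -leNgt; exact: OPT_le.
have /andP[b0 b1] := decay_factor_itv R kappa chi chi_gt1 kappa_ge1.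
set b := chi `^ _ in b0 b1 *; set L := chi / (1 - b).
have b1' : 0 < 1 - b by rewrite subr_gt0.
have L0 : 0 < L by rewrite divr_gt0.
rewrite leNgt; apply/negP => c'L.
(* Raising [c'] to at least 1 keeps it below [L + 1]; it makes [c] nonnegative, so that the bound on
   [W] can be multiplied by it, and keeps [d] below 1. *)
pose c := Num.max c' 1.
have cL : c < L + 1 by rewrite gt_max c'L ltrDr.
have c1 : 1 <= c by rewrite le_max lexx orbT.
(* The offline sum loses a factor [1 - d] twice, once through [gamma] and once through the
   finiteness of [M]. This [d] is small enough because [(1 - d) ^ 2 * L > L - 2 * L * d = c - 1]. *)
pose d := (L + 1 - c) / (2 * L).
have dE : 2 * L * d = L + 1 - c by rewrite /d; field; rewrite lt0r_neq0.
have d0 : 0 < d by rewrite divr_gt0 ?subr_gt0 // mulr_gt0.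
have d1 : d < 1 by nra.
have [g g0 gE] : exists2 g, 0 < g & chi `^ (- g) = d.
  by apply: powR_onto01; rewrite ?d0.
have [h h0 hE] : exists2 g, 0 < g & chi `^ (- g) = 1 - d.
  by apply: powR_onto01; rewrite // subr_gt0 d1 gtrBl.
(* Halving [h] gives [chi ^ (- gamma) > 1 - d], and [M > kappa * g] gives [d * Q * chi > 1]
   below. *)
pose gamma := h / 2; pose M := Num.bound (kappa%:R * g).
(* Then [(M + 1) * eps] equals [gamma / (1 + gamma)], which is below both 1 and [gamma]. *)
pose eps := gamma / (1 + gamma) / M.+1%:R.
have gamma0 : 0 < gamma by rewrite divr_gt0.
have eps0 : 0 < eps by rewrite !divr_gt0 ?addr_gt0.
have epsE : M.+1%:R * eps = gamma / (1 + gamma).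
  by rewrite mulrC divfK // pnatr_eq0.
have eps_lt1 : M.+1%:R * eps < 1.
  by rewrite epsE ltr_pdivrMr ?addr_gt0 // mul1r ltrDr.
have eps_lt_gamma : M.+1%:R * eps < gamma.
  by rewrite epsE ltr_pdivrMr ?addr_gt0 //; nra.
apply: (comp _ (hard_seq R kappa chi M eps gamma)).
  exact: hard_seq_in_class.
apply: lt_le_trans (OPT_hard_ge _ _ _ kappa_ge1 chi_gt1 _ _ _ eps0 eps_lt1).
have Wle := welfare_greedy_le R kappa chi tie kappa_ge1 chi_gt1 tie_ok M eps
  gamma eps0 eps_lt1 eps_lt_gamma.
set W := welfare _ _ in Wle *; set Q := chi `^ (M%:R / kappa%:R) in Wle *.
have W0 : 0 <= W.
  apply: sumr_ge0 => i _; apply: ltW.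
  have := hard_seq_in_class R kappa chi kappa_ge1 chi_gt1 M eps gamma eps0.
  by move=> /(_ i)[].
have Q0 : 0 < Q by apply: powR_gt0.
apply: (@le_lt_trans _ _ (c * Q)).
  apply: (@le_trans _ _ (c * W)).
    by rewrite ler_wpM2r // le_max lexx.
  by rewrite ler_wpM2l // (le_trans _ c1).
have := sum_powR_telescope R kappa chi chi_gt1 (M + kappa).
set S := \sum_(j < _) _; rewrite -/b => SE.
have NE : chi `^ ((M + kappa)%:R / kappa%:R) = Q * chi.
  rewrite natrD mulrDl divff ?pnatr_eq0 -?lt0n // powRD_gt0 //.
  by rewrite powRr1 // ltW.
rewrite NE in SE.
have dQ : 1 < d * Q * chi.
  rewrite -mulrA -NE -gE -powRD_gt0 // -[ltLHS](powRr0 chi).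
  apply: ltr_powR_base_gt1 => //; rewrite addrC subr_gt0.
  rewrite ltr_pdivlMr ?ltr0n // mulrC.
  apply: (lt_le_trans (archi_boundP _)); first by rewrite mulr_ge0 // ltW.
  by rewrite ler_nat leq_addr.
have hg : 1 - d < chi `^ (- gamma).
  by rewrite -hE ltr_powR_base_gt1 // ltrN2 /gamma; lra.
(* The telescoped sum is [Q * chi - 1], and the 1 subtracted is less than [d * Q * chi]. *)
have SL : (1 - d) * Q * L < S.
  rewrite -(ltr_pM2l b1') SE /L.
  have -> : (1 - b) * ((1 - d) * Q * (chi / (1 - b))) = (1 - d) * Q * chi.
    by field; rewrite lt0r_neq0.
  by nra.
have S0 : 0 < S.
  apply: le_lt_trans SL; rewrite mulr_ge0 ?(ltW L0) // mulr_ge0 ?(ltW Q0) //.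
  by rewrite subr_ge0 ltW.
(* The three inequalities chain to [(c - 1) * Q < chi ^ (- gamma) * S]; adding [Q], the value of
   blocker [M], contradicts competitiveness. *)
have : (1 - d) * S < chi `^ (- gamma) * S by rewrite ltr_pM2r.
have : (1 - d) * ((1 - d) * Q * L) < (1 - d) * S.
  by rewrite ltr_pM2l // subr_gt0.
have : (c - 1) * Q < (1 - d) * ((1 - d) * Q * L).
  have -> : (1 - d) * ((1 - d) * Q * L) = ((1 - d) ^+ 2 * L) * Q by ring.
  rewrite ltr_pM2r //.
  have -> : (1 - d) ^+ 2 * L = L - 2 * L * d + d * d * L by ring.
  rewrite dE; have : 0 < d * d * L by rewrite mulr_gt0 // mulr_gt0.
  lra.
lra.
Qed.
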